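(* Let $d=2$ and let $\mathbb{P}$ be a probability measure on $\Omega=\mathbb{R}^{\mathcal{E}^2}$ satisfying assumptions A1 and A2 below. Then $\mathbb{P}$-almost surely, the undirected nearest neighbor graph $\mathcal{N}$ has at most two infinite connected components.
   Context: $\mathcal{E}^2$ is the set of nearest-neighbor edges $\{x,y\}$ ($\|x-y\|_1=1$) of $\mathbb{Z}^2$; $\Omega$ carries the product Borel sigma-algebra and $\omega\in\Omega$ assigns a weight $\omega(e)$ to each edge. A1 (translation invariance): for every $z\in\mathbb{Z}^2$, $\mathbb{P}=\mathbb{P}\circ T_z^{-1}$ where $(T_z\omega)(e)=\omega(e+z)$, $e+z=\{x+z,y+z\}$ for $e=\{x,y\}$. A2: for distinct $e,f\in\mathcal{E}^2$, $\mathbb{P}(\omega(e)=\omega(f))=0$. The directed nearest neighbor graph $\mathcal{N}_D$ has vertex set $\mathbb{Z}^2$ and directed edges $\langle x,y\rangle$ for all $\{x,y\}\in\mathcal{E}^2$ with $\omega(\{x,y\})\le\omega(\{x,z\})$ for all $z$ with $\{x,z\}\in\mathcal{E}^2$. The undirected nearest neighbor graph $\mathcal{N}$ has vertex set $\mathbb{Z}^2$ and edge set $\{\{x,y\}:\langle x,y\rangle \text{ is an edge of } \mathcal{N}_D\}$. *)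

(* Defs.v *)
From HB Require Import structures.
From mathcomp Require Import all_boot all_order all_algebra.
From mathcomp Require Import all_classical all_reals all_analysis.
From Stdlib Require Import Relations.
Set Implicit Arguments. Unset Strict Implicit. Unset Printing Implicit Defensive.
Import Order.TTheory GRing.Theory Num.Theory.
Local Open Scope classical_set_scope.
Local Open Scope ring_scope.

Definition pt := (int * int)%type.

(* Nearest-neighbour edges of Z^2, encoded canonically: (x, false) is the
   edge {x, x + e_1} and (x, true) is the edge {x, x + e_2}.  This is a
   bijection with the set E^2 of unordered nearest-neighbour pairs. *)
Definition edge := (pt * bool)%type.

Definition adjacent (x y : pt) : bool :=
  (absz (x.1 - y.1) + absz (x.2 - y.2) == 1)%N.

(* The (canonical code of the) unordered edge {x,y}, for adjacent x y. *)
Definition edge_of (x y : pt) : edge :=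
  if y == (x.1 + 1, x.2) then (x, false)
  else if x == (y.1 + 1, y.2) then (y, false)
  else if y == (x.1, x.2 + 1) then (x, true)
  else (y, true).

Definition edge_shift (z : pt) (e : edge) : edge :=
  ((e.1.1 + z.1, e.1.2 + z.2), e.2).

Definition cylinders (R : realType) : set (set (edge -> R)) :=
  [set A | exists (e : edge) (B : set R), measurable B /\
           A = (fun w : edge -> R => w e) @^-1` B].

Definition weights (R : realType) := (edge -> R)%type.
HB.instance Definition _ (R : realType) := Choice.on (weights R).
HB.instance Definition _ (R : realType) := isPointed.Build (weights R) (fun=> 0).

Definition Omega (R : realType) := g_sigma_algebraType (@cylinders R : set (set (weights R))).

Definition T_shift (R : realType) (z : pt) (w : Omega R) : Omega R :=
  fun e => w (edge_shift z e).

Section Graphs.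
Variable R : realType.
Variable w : Omega R.

Definition weight (x y : pt) : R := w (edge_of x y).

Definition ND_edge (x y : pt) : Prop :=
  adjacent x y /\ forall z : pt, adjacent x z -> weight x y <= weight x z.

Definition N_edge (x y : pt) : Prop := ND_edge x y \/ ND_edge y x.

Definition N_connected : pt -> pt -> Prop := clos_refl_trans pt N_edge.

Definition N_component (x : pt) : set pt := [set y | N_connected x y].

Definition infinite_N_component (C : set pt) : Prop :=
  (exists x, C = N_component x) /\ ~ finite_set C.

Definition at_most_two_infinite_components : Prop :=
  forall C1 C2 C3 : set pt,
    infinite_N_component C1 -> infinite_N_component C2 ->
    infinite_N_component C3 ->
    C1 = C2 \/ C1 = C3 \/ C2 = C3.
End Graphs.

Definition translation_invariant (R : realType)
  (P : probability (Omega R) R) : Prop :=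
  forall (z : pt) (A : set (Omega R)), measurable A ->
    P (T_shift z @^-1` A) = P A.

Definition distinct_weights (R : realType)
  (P : probability (Omega R) R) : Prop :=
  forall e f : edge, e <> f -> P [set w : Omega R | w e = w f] = 0%E.

(* Main.v *)
Require Import Defs.
From HB Require Import structures.
From mathcomp Require Import all_boot all_order all_algebra.
From mathcomp Require Import all_classical all_reals all_analysis.
From mathcomp Require Import measurable_realfun zify.
From Stdlib Require Import Relations.
Import Defs. (* mathcomp-analysis has its own [adjacent] *)
Set Implicit Arguments.
Unset Strict Implicit.
Unset Printing Implicit Defensive.
Import Order.TTheory GRing.Theory Num.Theory.
Local Open Scope classical_set_scope.
Local Open Scope ring_scope.

(* Almost surely there are no ties, so every vertex has a unique nearest
   neighbour and weights decrease along forward orbits.  Let every x send unit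
   mass to the first vertex of its orbit whose outgoing weight is at most a
   rational q: by translation invariance each vertex receives finite expected
   mass, and varying q shows that every vertex has finitely many ancestors.
   Hence in an infinite component all forward orbits are infinite.

   If three infinite components exist with positive probability, then with
   positive probability a fixed box contains three points with disjoint
   infinite orbits and has all its ancestors in a larger fixed box; call it a
   trifurcation.  Among sparse translates there are of order m^2 expected
   trifurcations in a square of side of order m, and no orbit started in one
   visits another.  The three orbits of a trifurcation, joined inside its box,
   form mod-2 cycles and so colour the unit squares of the plane; at least
   three colours occur on the perimeter of the large square.  By parity, for
   two trifurcations one colour of the first and one of the second together
   cover the plane.  Such a family has at most as many members as the perimeter
   has squares, as the position at which a third colour first appears
   determines the member: the bound O(m) contradicts the order m^2. *)

(** * Counting colourings by the position of their third colour *)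

(** The position [l i] at which a third colour first appears is below [n] and determines [i], so [l]
    embeds [I] into ['I_n]. *)
Lemma third_color_bound (I : finType) (C : eqType) (n : nat)
    (chi : I -> nat -> C) :
  (forall i, exists a b c, [/\ (a < n)%N, (b < n)%N & (c < n)%N] /\
     [/\ chi i a != chi i b, chi i a != chi i c & chi i b != chi i c]) ->
  (forall i j, i != j -> exists s t, forall y, chi i y = s \/ chi j y = t) ->
  (#|I| <= n)%N.
Proof.
move=> three compat.
(* The colour at [y] differs from the initial one and from a second colour already seen before
   [y]. *)
pose new i y := [exists z : 'I_y, (chi i z != chi i 0) && (chi i z != chi i y)]
  && (chi i y != chi i 0).
have newI i a b : (a < n)%N -> (b < n)%N -> chi i a != chi i 0 ->
    chi i b != chi i 0 -> chi i a != chi i b -> exists y, new i y && (y < n)%N.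
  move=> an bn a0 b0 ab; case: (ltngtP a b) => [lab|lba|eab].
  - exists b; rewrite /new bn b0 !andbT; apply/existsP.
    by exists (Ordinal lab) => /=; rewrite a0.
  - exists a; rewrite /new an a0 !andbT; apply/existsP.
    by exists (Ordinal lba) => /=; rewrite b0 eq_sym.
  - by rewrite eab eqxx in ab.
have ex_new i : exists y, new i y && (y < n)%N.
  have [a [b [c [[an bn cn] [ab ac bc]]]]] := three i.
  have [ea|na] := eqVneq (chi i a) (chi i 0).
    by apply: (newI i b c) => //; rewrite -ea eq_sym.
  have [eb|nb] := eqVneq (chi i b) (chi i 0).
    by apply: (newI i a c) => //; rewrite -eb eq_sym.
  exact: (newI i a b).
pose l i := ex_minn (ex_new i).
have lP i : [/\ new i (l i), (l i < n)%N & forall y, (y < l i)%N -> ~~ new i y].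
  rewrite /l; case: ex_minnP => y /andP[ny yn] ymin; split=> // z zy.
  apply/negP => nz; have /ymin : new i z && (z < n)%N by rewrite nz (ltn_trans zy).
  by rewrite leqNgt zy.
(* Had the colour at [l i] occurred at some [y] before it, then the later of [y] and [z] would
   already be [new], against minimality. *)
have fresh i y : (y < l i)%N -> chi i y != chi i (l i).
  have [+ _ lmin] := lP i => /andP[/existsP[z /andP[z0 zl]] l0] yl.
  apply/negP => /eqP eyl; have zy : z != y :> nat.
    by apply: contraNneq zl => ->; rewrite eyl.
  case: (ltngtP z y) => [lt|lt|e]; last by rewrite e eqxx in zy.
  - have /negP := lmin _ yl; apply; rewrite /new eyl l0 andbT.
    by apply/existsP; exists (Ordinal lt); rewrite /= z0.
  - have /negP := lmin _ (ltn_ord z); apply; rewrite /new z0 andbT.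
    by apply/existsP; exists (Ordinal lt); rewrite /= eyl l0 eq_sym.
(* Colouring [i] leaves [s] at the second-colour position [z] and at [l i], so [j] shows [t] at
   both; yet [j] should show a fresh colour at [l j = l i]. *)
have half i j s t : (forall y, chi i y = s \/ chi j y = t) ->
    chi i 0 = s -> l i = l j -> False.
  move=> cov e0 el; have [+ _ _] := lP i => /andP[/existsP[z /andP[z0 zl]] l0].
  have tl : chi j (l i) = t by case: (cov (l i)) => // e; rewrite e e0 eqxx in l0.
  have tz : chi j z = t by case: (cov z) => // e; rewrite e e0 eqxx in z0.
  have := @fresh j z; rewrite -el => /(_ (ltn_ord z)).
  by rewrite tl tz eqxx.
have linj : injective (fun i => Ordinal (let: And3 _ h _ := lP i in h)).
  move=> i j [el]; apply/eqP; apply: contraT => ij.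
  have [s [t cov]] := compat _ _ ij.
  case: (cov 0) => e; first by case: (half i j s t cov e el).
  by case: (half j i t s) => // y; case: (cov y); [right|left].
by rewrite -[n in (_ <= n)%N]card_ord; apply: leq_card linj.
Qed.

(** * Mod-2 chains on the square lattice *)

Definition east (v : pt) : pt := (v.1 + 1, v.2).
Definition west (v : pt) : pt := (v.1 - 1, v.2).
Definition north (v : pt) : pt := (v.1, v.2 + 1).
Definition south (v : pt) : pt := (v.1, v.2 - 1).

Ltac pt_lia := rewrite /adjacent /east /west /north /south /= ?xpair_eqE /=; lia.

Lemma adjacentE (x y : pt) :
  adjacent x y = [|| y == east x, y == west x, y == north x | y == south x].
Proof. by case: x y => [a b] [c d]; pt_lia. Qed.

Lemma adjacent_sym (x y : pt) : adjacent x y = adjacent y x.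
Proof. by case: x y => [a b] [c d]; pt_lia. Qed.

Lemma adjacent_neq (x y : pt) : adjacent x y -> x != y.
Proof. by case: x y => [a b] [c d]; pt_lia. Qed.

Lemma westK (v : pt) : west (east v) = v.
Proof. by case: v => a b; rewrite /west /east /= addrK. Qed.
Lemma eastK (v : pt) : east (west v) = v.
Proof. by case: v => a b; rewrite /west /east /= subrK. Qed.
Lemma southK (v : pt) : south (north v) = v.
Proof. by case: v => a b; rewrite /south /north /= addrK. Qed.
Lemma northK (v : pt) : north (south v) = v.
Proof. by case: v => a b; rewrite /south /north /= subrK. Qed.

Lemma edge_of_east v : edge_of v (east v) = (v, false).
Proof. by rewrite /edge_of eqxx. Qed.
Lemma edge_of_west v : edge_of v (west v) = (west v, false).
Proof.
rewrite /edge_of; case: ifP => [|_]; first by case: v => a b; pt_lia.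
by rewrite ifT //; case: v => a b; pt_lia.
Qed.
Lemma edge_of_north v : edge_of v (north v) = (v, true).
Proof.
rewrite /edge_of; do 2!(rewrite ifF; last by case: v => a b; pt_lia).
by rewrite eqxx.
Qed.
Lemma edge_of_south v : edge_of v (south v) = (south v, true).
Proof.
by rewrite /edge_of; do 3!(rewrite ifF; last by case: v => a b; pt_lia).
Qed.
Definition edge_ofE := (edge_of_east, edge_of_west, edge_of_north, edge_of_south).

Variant adjacent_spec (x : pt) : pt -> bool -> Prop :=
| AdjE : adjacent_spec x (east x) true
| AdjW : adjacent_spec x (west x) true
| AdjN : adjacent_spec x (north x) true
| AdjS : adjacent_spec x (south x) true
| AdjNot y : adjacent_spec x y false.

Lemma adjacentP x y : adjacent_spec x y (adjacent x y).
Proof.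
by case: (boolP (adjacent x y)) => [|_]; [rewrite adjacentE => /or4P[] /eqP ->|];
  constructor.
Qed.

Lemma edge_ofC x y : adjacent x y -> edge_of x y = edge_of y x.
Proof.
case: adjacentP => // _; rewrite edge_ofE.
- by rewrite -{3}(westK x) edge_of_west westK.
- by rewrite -{3}(eastK x) edge_of_east.
- by rewrite -{3}(southK x) edge_of_south southK.
- by rewrite -{3}(northK x) edge_of_north.
Qed.

Lemma edge_of_inj x y u v : adjacent x y -> adjacent u v ->
  edge_of x y = edge_of u v -> (x = u /\ y = v) \/ (x = v /\ y = u).
Proof.
move: x u => [a b] [c d]; case: adjacentP => // _; case: adjacentP => // _;
  rewrite !edge_ofE /east /west /north /south /= => -[] // *;
  (by left; split; congr pair; lia) || (by right; split; congr pair; lia).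
Qed.

Lemma edge_ofP (e : edge) : exists x y, adjacent x y /\ e = edge_of x y.
Proof.
case: e => v [].
- by exists v, (north v); rewrite edge_of_north adjacentE eqxx !orbT.
- by exists v, (east v); rewrite edge_of_east adjacentE eqxx.
Qed.

(* The unit square with lower-left corner v is denoted by v; the edge e lies
   between the squares e.1 and [other_side e]. *)
Definition other_side (e : edge) : pt := if e.2 then west e.1 else south e.1.

Definition boundary (X : pt -> bool) (e : edge) : bool :=
  X e.1 (+) X (other_side e).

(** The boundary operator on mod-2 chains: the parity of the degree of [v] in [c]. *)
Definition divergence (c : edge -> bool) (v : pt) : bool :=
  c (v, false) (+) c (west v, false) (+) (c (v, true) (+) c (south v, true)).

Lemma divergenceE c v : divergence c v =
  c (edge_of v (east v)) (+) c (edge_of v (west v)) (+)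
  (c (edge_of v (north v)) (+) c (edge_of v (south v))).
Proof. by rewrite !edge_ofE. Qed.

Lemma divergence_boundary X v : divergence (boundary X) v = false.
Proof.
rewrite /divergence /boundary /other_side /=.
have -> : west (south v) = south (west v) by [].
by case: (X v); case: (X (west v)); case: (X (south v)); case: (X _).
Qed.

Lemma divergenceD c d v : divergence (fun e => c e (+) d e) v =
  divergence c v (+) divergence d v.
Proof.
rewrite /divergence [X in X (+) _]addbACA [X in _ (+) X]addbACA.
by rewrite addbACA.
Qed.

Lemma int_primitive (h : int -> bool) :
  exists H : int -> bool, H 0 = false /\ forall i, H i (+) H (i - 1) = h i.
Proof.
(* [Negz n] is -(n+1), hence [n.+1] terms there, starting from [h 0]. *)
pose H (i : int) : bool := match i with
  | Posz n => \big[addb/false]_(k < n) h (k.+1)%:Z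
  | Negz n => \big[addb/false]_(k < n.+1) h (- (k%:Z)) end.
exists H; split=> [|[[|n]|n]]; first by rewrite /= big_ord0.
- by rewrite (_ : 0%:Z - 1 = Negz 0) //= big_ord0 big_ord1.
- rewrite (_ : n.+1%:Z - 1 = n%:Z) /=; last by lia.
  by rewrite big_ord_recr /= addbAC addbb.
- rewrite (_ : Negz n - 1 = Negz n.+1) /=; last by lia.
  by rewrite [in X in _ (+) X]big_ord_recr /= addbA addbb addFb NegzE.
Qed.

Lemma int_constant (T : Type) (h : int -> T) :
  (forall i, h i = h (i - 1)) -> forall i, h i = h 0.
Proof.
move=> hS; case=> n; elim: n => [|n IH] //.
- by rewrite hS -IH; congr h; lia.
- by rewrite -IH [RHS]hS; congr h; lia.
Qed.

(** The plane has no mod-2 homology in degree one. The primitive [S] integrates [c] along the row at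
    height 0 and then up each column. *)
Lemma divergence_free_boundary c : (forall v, divergence c v = false) ->
  exists S, forall e, boundary S e = c e.
Proof.
move=> c0; have [g [_ gS]] := int_primitive (fun i => c ((i, 0), true)).
have /choice[H HS] := fun a => int_primitive (fun i => c ((a, i), false)).
pose S (v : pt) := g v.1 (+) H v.1 v.2.
have SN v : S v (+) S (south v) = c (v, false).
  case: v => a b; have [_ <-] := HS a; rewrite /S /=.
  by case: (g a); case: (H a b); case: (H a _).
exists S => -[[a b] []]; last exact: SN.
rewrite /boundary /other_side /=.
(* [D] is the error at the vertical edges of column [a]. Vanishing divergence makes it independent
   of the height, and the choice of [g] makes it zero at height 0. *)
pose D b' := S (a, b') (+) S (west (a, b')) (+) c ((a, b'), true).
have : D b = D 0.
  apply: (@int_constant _ D) => i; rewrite /D.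
  have := c0 (a, i); have := SN (west (a, i)); have := SN (a, i).
  rewrite /divergence.
  have -> : south (west (a, i)) = west (a, i - 1) by [].
  have -> : south (a, i) = (a, i - 1) by [].
  move: (c ((a, i), true)) (c ((a, i - 1), true)) => c3 c4 <- <-.
  move: (S (a, i)) (S (a, i - 1)) (S (west (a, i))) (S (west (a, i - 1))).
  by move: c3 c4 => [] [] [] [] [] [].
have -> : D 0 = false.
  rewrite /D /S /west /=.
  have [-> _] := HS a; have [-> _] := HS (a - 1); rewrite !addbF -gS.
  by rewrite addbb.
by rewrite /D; case: (c _); case: (S _); case: (S _).
Qed.

Lemma boundary0_constant X : (forall e, boundary X e = false) ->
  forall u v, X u = X v.
Proof.
move=> X0; suff h v : X v = X (0, 0) by move=> u v; rewrite !h.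
case: v => a b; transitivity (X (a, 0)).
  apply: (@int_constant _ (fun i => X (a, i))) => i; apply/eqP.
  by have := X0 ((a, i), false); rewrite /boundary; case: (X _); case: (X _).
apply: (@int_constant _ (fun i => X (i, 0))) => i; apply/eqP.
by have := X0 ((i, 0), true); rewrite /boundary; case: (X _); case: (X _).
Qed.

Lemma adjacent_east v : adjacent v (east v).
Proof. by rewrite adjacentE eqxx. Qed.
Lemma adjacent_west v : adjacent v (west v).
Proof. by rewrite adjacentE eqxx !orbT. Qed.
Lemma adjacent_north v : adjacent v (north v).
Proof. by rewrite adjacentE eqxx !orbT. Qed.
Lemma adjacent_south v : adjacent v (south v).
Proof. by rewrite adjacentE eqxx !orbT. Qed.
#[local] Hint Resolve adjacent_east adjacent_west adjacent_north adjacent_south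
  : core.

Lemma addb_neighbours v w : adjacent v w ->
  (east v == w) (+) (west v == w) (+) ((north v == w) (+) (south v == w)) = true.
Proof. by case: v w => [a b] [c d]; pt_lia. Qed.

Lemma divergence_eq c d v :
  (forall u, adjacent v u -> c (edge_of v u) = d u) ->
  divergence c v = d (east v) (+) d (west v) (+) (d (north v) (+) d (south v)).
Proof. by move=> cd; rewrite divergenceE !cd. Qed.

(** A vertex of even degree cannot carry exactly one edge. *)
Lemma divergence_single c v w : divergence c v = false -> adjacent v w ->
  (forall u, adjacent v u -> u != w -> c (edge_of v u) = false) ->
  c (edge_of v w) = false.
Proof.
move=> c0 vw cw; apply/negP => cvw.
suff : divergence c v = true by rewrite c0.
rewrite (divergence_eq (d := pred1 w)) ?addb_neighbours // => u vu /=.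
by have [->|/cw ->] := eqVneq u w.
Qed.

(** Connectedness as an induction principle, so that it applies directly to any equivalence relation
    containing adjacency inside [B]. *)
Definition lattice_connected (B : pt -> Prop) := forall r : pt -> pt -> Prop,
  (forall x, r x x) -> (forall x y, r x y -> r y x) ->
  (forall x y z, r x y -> r y z -> r x z) ->
  (forall x y, B x -> B y -> adjacent x y -> r x y) ->
  forall x y, B x -> B y -> r x y.

Definition edge_inside (B : pt -> Prop) (e : edge) :=
  exists u v, [/\ B u, B v, adjacent u v & e = edge_of u v].

Lemma edge_inside_end B u v : adjacent u v -> edge_inside B (edge_of u v) ->
  B u /\ B v.
Proof.
move=> uv [a [b [Ba Bb ab]]] /(edge_of_inj uv ab).
by case=> -[-> ->].
Qed.

(** Being joined by a chain inside [B] is an equivalence relation, since chains add mod 2; a single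
    edge joins its ends. *)
Lemma chain_between B x y : lattice_connected B -> B x -> B y ->
  exists c : edge -> bool, (forall e, c e -> edge_inside B e) /\
    forall v, divergence c v = (v == x) (+) (v == y).
Proof.
move: x y => + + cB; apply: cB => [x|x y [c [cB dc]]|x y z [c [cB dc]] [d [dB dd]]|].
- by exists (fun=> false); split=> // v; rewrite addbb.
- by exists c; split=> // v; rewrite addbC dc.
- exists (fun e => c e (+) d e); split=> [e|v].
    by case: (boolP (c e)) => [/cB //|_ /dB].
  by rewrite divergenceD dc dd addbA addbK.
- move=> x y Bx By xy; exists (pred1 (edge_of x y)); split=> [e /eqP ->|v].
    by exists x, y.
  have xNy := adjacent_neq xy.
  have [->|vx] := eqVneq v x.
    rewrite (negbTE xNy) (divergence_eq (d := fun u => u == y)) ?addb_neighbours //.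
    move=> u xu /=; apply/eqP/eqP => [|-> //].
    by case/(edge_of_inj xu xy) => -[// e1 e2]; rewrite e1 eqxx in xNy.
  have [->|vy] := eqVneq v y.
    rewrite (divergence_eq (d := fun u => u == x)).
      by rewrite addb_neighbours // adjacent_sym.
    move=> u yu /=; apply/eqP/eqP => [|->]; last by rewrite -edge_ofC.
    by case/(edge_of_inj yu xy) => -[// e1 e2]; rewrite e1 eqxx in xNy.
  rewrite (divergence_eq (d := fun=> false)) // => u vu /=.
  apply/eqP => /(edge_of_inj vu xy)[[e _]|[e _]].
    by rewrite e eqxx in vx.
  by rewrite e eqxx in vy.
Qed.

(** The four unit squares having [v] as a corner. *)
Definition touches (v f : pt) : bool :=
  [|| f == v, f == west v, f == south v | f == west (south v)].

Lemma touches_edge u v : adjacent u v ->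
  touches u (edge_of u v).1 && touches u (other_side (edge_of u v)).
Proof.
by case: adjacentP => // _; rewrite edge_ofE /touches /other_side /= !eqxx ?orbT.
Qed.

Lemma touches_edge_r u v : adjacent u v ->
  touches v (edge_of u v).1 && touches v (other_side (edge_of u v)).
Proof. by move=> uv; rewrite edge_ofC // touches_edge // adjacent_sym. Qed.

(** * Colourings defined by disjoint orbits *)

Section Orbits.
Variable s : pt -> pt.
Hypothesis s_adj : forall x, adjacent x (s x).

Definition injective_orbit x := forall k l, iter k s x = iter l s x -> k = l.

Definition disjoint_orbits x y := forall k l, iter k s x <> iter l s y.

Definition orbit_edge x (e : edge) : bool :=
  `[< exists k, e = edge_of (iter k s x) (iter k.+1 s x) >].

Lemma orbit_edgeP x v u : adjacent v u -> orbit_edge x (edge_of v u) <->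
  exists k, (v = iter k s x /\ u = iter k.+1 s x) \/
            (u = iter k s x /\ v = iter k.+1 s x).
Proof.
move=> vu; split=> [/asboolP[k e]|[k [[-> ->]|[-> ->]]]].
- by exists k; case: (edge_of_inj vu (s_adj (iter k s x)) e) => -[-> ->]; [left|right].
- by apply/asboolP; exists k.
- by apply/asboolP; exists k; rewrite edge_ofC // adjacent_sym s_adj.
Qed.

(** An injective orbit is a one-ended path: later vertices have degree two, and only the start has
    odd degree. *)
Lemma divergence_orbit_edge x v : injective_orbit x ->
  divergence (orbit_edge x) v = (v == x).
Proof.
move=> ix; case: (pselect (exists k, v = iter k s x)) => [[[|k] vk]|nv].
- rewrite vk eqxx (divergence_eq (d := fun u => u == s x)) ?addb_neighbours //.
  move=> u xu; apply/idP/eqP => [/(orbit_edgeP _ xu)[k [[e1 e2]|[_ e2]]]|->].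
  + by rewrite e2 /= -e1.
  + by have := ix 0%N k.+1 e2.
  + by apply/orbit_edgeP => //; exists 0%N; left.
- have vx : v != x.
    by apply/eqP => vx; have := ix 0%N k.+1; rewrite -{}vk vx => /(_ erefl).
  have svk : s v != iter k s x.
    apply/eqP => svk; have := ix k.+2 k; rewrite iterS -vk svk => /(_ erefl); lia.
  rewrite (negbTE vx) (divergence_eq (d := fun u => (u == s v) (+) (u == iter k s x))).
    rewrite [X in X (+) _]addbACA [X in _ (+) X]addbACA addbACA.
    rewrite !addb_neighbours // vk adjacent_sym; exact: s_adj.
  move=> u vu; apply/idP/idP => [/(orbit_edgeP _ vu)[l [[e1 e2]|[e1 e2]]]|].
  + by rewrite e2 iterS -e1 eqxx (negbTE svk).
  + have /ix[kl] : iter k.+1 s x = iter l.+1 s x by rewrite -vk.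
    by rewrite e1 -kl eqxx eq_sym (negbTE svk).
  + have [-> _|_ /eqP ->] := eqVneq u (s v); apply/orbit_edgeP => //.
    * by exists k.+1; left; split=> //; rewrite iterS -vk.
    * by rewrite vk adjacent_sym s_adj.
    * by exists k; right.
- rewrite (divergence_eq (d := fun=> false)).
    by apply/esym/eqP => vx; apply: nv; exists 0%N.
  move=> u vu; apply/negP => /(orbit_edgeP _ vu)[k [[e _]|[_ e]]]; apply: nv.
    by exists k.
  by exists k.+1.
Qed.

Definition tripod (B : pt -> Prop) x1 x2 x3 :=
  [/\ B x1, B x2 & B x3] /\
  [/\ injective_orbit x1, injective_orbit x2 & injective_orbit x3] /\
  [/\ disjoint_orbits x1 x2, disjoint_orbits x1 x3 & disjoint_orbits x2 x3].

(** The colour may change only across edges inside [B] or edges of the orbits from [xs]. *)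
Definition supported (C : eqType) (B : pt -> Prop) (xs : seq pt) (chi : pt -> C) :=
  forall e, chi e.1 != chi (other_side e) ->
    edge_inside B e \/ exists2 x, x \in xs & orbit_edge x e.

Lemma orbit_edge_disjoint x y k : disjoint_orbits x y ->
  orbit_edge y (edge_of (iter k s x) (iter k.+1 s x)) = false.
Proof.
move=> xy; apply/negP => /(orbit_edgeP _ (s_adj _))[l].
by case=> -[] => [/xy|+ /xy].
Qed.

Lemma orbit_edge_self x k : orbit_edge x (edge_of (iter k s x) (iter k.+1 s x)).
Proof. by apply/asboolP; exists k. Qed.

Lemma disjoint_orbits_sym x y : disjoint_orbits x y -> disjoint_orbits y x.
Proof. by move=> xy k l /esym /xy. Qed.

(* The squares are coloured by the pair of primitives of two mod-2 cycles:
   the orbits of x1 and x2 joined inside B, and those of x2 and x3. *)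
Lemma tripod_coloring B x1 x2 x3 : lattice_connected B -> tripod B x1 x2 x3 ->
  exists chi : pt -> bool * bool,
  [/\ supported B [:: x1; x2; x3] chi,
    forall k, let e := edge_of (iter k s x1) (iter k.+1 s x1) in
      ~ B (iter k.+1 s x1) ->
      chi (other_side e) = (~~ (chi e.1).1, (chi e.1).2) &
    forall k, let e := edge_of (iter k s x2) (iter k.+1 s x2) in
      ~ B (iter k.+1 s x2) ->
      chi (other_side e) = (~~ (chi e.1).1, ~~ (chi e.1).2)].
Proof.
move=> cB [[B1 B2 B3] [[i1 i2 i3] [d12 d13 d23]]].
have [p [pB dp]] := chain_between cB B1 B2.
have [q [qB dq]] := chain_between cB B2 B3.
have [e|S eS] := @divergence_free_boundary
    (fun e => (orbit_edge x1 e (+) orbit_edge x2 e) (+) p e).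
  by rewrite !divergenceD !divergence_orbit_edge // dp addbb.
have [e|T eT] := @divergence_free_boundary
    (fun e => (orbit_edge x2 e (+) orbit_edge x3 e) (+) q e).
  by rewrite !divergenceD !divergence_orbit_edge // dq addbb.
(* Across an orbit edge that ends outside [B] the joining chains contribute nothing, so the orbits
   alone decide which components flip. *)
have out (c : edge -> bool) x k : (forall e, c e -> edge_inside B e) ->
    ~ B (iter k.+1 s x) -> c (edge_of (iter k s x) (iter k.+1 s x)) = false.
  by move=> cI nB; apply/negP => /cI h; case: (edge_inside_end (s_adj _) h).
have flip a b : a (+) b = true -> b = ~~ a by case: a b => [] [].
have keep a b : a (+) b = false -> b = a by case: a b => [] [].
exists (fun f => (S f, T f)); split.
- move=> e /=; rewrite xpair_eqE negb_and => /orP[] ne.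
  + have : boundary S e = true.
      by rewrite /boundary; case: (S e.1) ne; case: (S _).
    rewrite eS; case: (boolP (p e)) => [/pB ?|_]; first by left.
    rewrite addbF; case: (boolP (orbit_edge x1 e)) => [h _|_ /= h].
      by right; exists x1; rewrite // !inE eqxx.
    by right; exists x2; rewrite // !inE eqxx orbT.
  + have : boundary T e = true.
      by rewrite /boundary; case: (T e.1) ne; case: (T _).
    rewrite eT; case: (boolP (q e)) => [/qB ?|_]; first by left.
    rewrite addbF; case: (boolP (orbit_edge x2 e)) => [h _|_ /= h].
      by right; exists x2; rewrite // !inE eqxx orbT.
    by right; exists x3; rewrite // !inE eqxx !orbT.
- move=> k e nB /=; congr pair.
  + apply: flip; rewrite [LHS]eS (out _ _ _ pB nB).
    by rewrite orbit_edge_self orbit_edge_disjoint.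
  + apply: keep; rewrite [LHS]eT (out _ _ _ qB nB).
    by rewrite !orbit_edge_disjoint.
- move=> k e nB /=; congr pair.
  + apply: flip; rewrite [LHS]eS (out _ _ _ pB nB).
    by rewrite orbit_edge_self orbit_edge_disjoint //; apply: disjoint_orbits_sym.
  + apply: flip; rewrite [LHS]eT (out _ _ _ qB nB).
    by rewrite orbit_edge_self orbit_edge_disjoint.
Qed.

(** No edge at [v] carries a colour change, and crossing three of them links the four squares around
    [v]. *)
Lemma supported_touches (C : eqType) B xs (chi : pt -> C) v f :
  supported B xs chi -> ~ B v -> (forall x k, x \in xs -> iter k s x <> v) ->
  touches v f -> chi f = chi v.
Proof.
move=> sup nB nO.
have same u : adjacent v u ->
    chi (edge_of v u).1 = chi (other_side (edge_of v u)).
  move=> vu; apply/eqP; apply: contraT => /sup[h|[x xs_x]].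
    by case: (edge_inside_end vu h).
  case/(orbit_edgeP _ vu) => k [[e _]|[_ e]].
    by case: (nO x k).
  by case: (nO x k.+1).
have := (same _ (adjacent_east v), same _ (adjacent_west v), same _ (adjacent_north v)).
rewrite !edge_ofE /other_side /= => -[[e1 e2] e3].
by case/or4P => /eqP ->; rewrite // -?e1 -?e3 // e3 e2.
Qed.

(** An injective orbit meets [v] at most once. The bound is the induction measure in
    [supported_compatible]. *)
Lemma orbit_hit_bound (ys : seq pt) v :
  (forall y, y \in ys -> injective_orbit y) ->
  exists n, forall y k, y \in ys -> iter k s y = v -> (k <= n)%N.
Proof.
elim: ys => [|y ys IH] inj; first by exists 0%N.
have [z zys|n nP] := IH; first by apply: inj; rewrite inE zys orbT.
case: (pselect (exists k, iter k s y = v)) => [[k yk]|ny].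
  exists (maxn n k) => z l; rewrite inE leq_max => /predU1P[->|zys zl].
    by rewrite -yk => /inj ->; rewrite ?inE ?eqxx // leqnn orbT.
  by rewrite (nP z l).
exists n => z l; rewrite inE => /predU1P[->|zys zl]; last exact: nP zl.
by move=> yl; case: ny; exists l.
Qed.

(* Let X be the set of squares violating the conclusion.  Its boundary has even
   degree at every vertex, is contained in the orbits and contains no edge
   meeting B or B'; following the (possibly merging) orbits from their starting
   points it must be empty. *)
Lemma supported_compatible (C : eqType) B B' xs xs' (chi chi' : pt -> C) b b' :
  lattice_connected B -> lattice_connected B' -> B b -> B' b' ->
  (forall v, B v -> ~ B' v) ->
  (forall x, x \in xs -> injective_orbit x) ->
  (forall x, x \in xs' -> injective_orbit x) ->
  (forall x k, x \in xs -> ~ B' (iter k s x)) ->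
  (forall x k, x \in xs' -> ~ B (iter k s x)) ->
  supported B xs chi -> supported B' xs' chi' ->
  forall f, chi f = chi b' \/ chi' f = chi' b.
Proof.
move=> cB cB' Bb Bb' BB' inj inj' out out' sup sup'.
(* The foreign colouring is constant around each vertex of [D]; adjacent vertices share a square, so
   by connectedness one colour surrounds all of [D]. *)
have near D D' ys (phi : pt -> C) d : lattice_connected D -> D d ->
    (forall v, D v -> ~ D' v) -> (forall x k, x \in ys -> ~ D (iter k s x)) ->
    supported D' ys phi -> forall v f, D v -> touches v f -> phi f = phi d.
  move=> cD Dd DD' oD supD v f Dv vf.
  have tch u g : D u -> touches u g -> phi g = phi u.
    move=> Du; apply: (supported_touches supD); first exact: DD'.
    by move=> x k xys e; apply: (oD x k xys); rewrite e.
  rewrite (tch v f) //.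
  apply: (cD (fun u v => phi u = phi v)) => // [x y z -> //|u w Du Dw uw].
  have /andP[/(tch u _ Du) <- // _] := touches_edge uw.
  by have /andP[/(tch w _ Dw) <- // _] := touches_edge_r uw.
have nearB := near B B' xs' chi' b cB Bb BB' out' sup'.
have nearB' := near B' B xs chi b' cB' Bb' (fun v b1 b2 => BB' v b2 b1) out sup.
pose X f := (chi f != chi b') && (chi' f != chi' b).
have Xnear v f : B v \/ B' v -> touches v f -> X f = false.
  by case=> Bv vf; rewrite /X ?(nearB _ _ Bv vf) ?(nearB' _ _ Bv vf) eqxx ?andbF.
have bnear u v : adjacent u v -> B u \/ B' u -> boundary X (edge_of u v) = false.
  by move=> uv Bu; have /andP[t1 t2] := touches_edge uv;
     rewrite /boundary !(Xnear u).
have bX e : boundary X e -> (edge_inside B e \/ edge_inside B' e) \/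
    exists2 x, x \in xs ++ xs' & orbit_edge x e.
  rewrite /boundary /X => h.
  have [e1|/sup[?|[x xx ox]]] := eqVneq (chi e.1) (chi (other_side e)); last 2 first.
    by left; left.
    by right; exists x => //; rewrite mem_cat xx.
  have [e2|/sup'[?|[x xx ox]]] := eqVneq (chi' e.1) (chi' (other_side e)); last 2 first.
    by left; right.
    by right; exists x => //; rewrite mem_cat xx orbT.
  by rewrite e1 e2 addbb in h.
(* Induction on the latest time [n] at which an orbit visits [v]. Orbit predecessors of [v] are
   visited strictly earlier, so the edges from them drop out and the outgoing edge would be the only
   one at [v]. *)
have orbit0 n v : (forall y k, y \in xs ++ xs' -> iter k s y = v -> (k <= n)%N) ->
    boundary X (edge_of v (s v)) = false.
  elim/ltn_ind: n v => n IH v hv.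
  case: (pselect (B v \/ B' v)) => [|nBv]; first exact: bnear.
  apply: (divergence_single (divergence_boundary X v)) => // u vu usv.
  apply/negP => bvu; case: (bX _ bvu) => [[]h|[x xx]].
  - by case: (edge_inside_end vu h) => Bv _; apply: nBv; left.
  - by case: (edge_inside_end vu h) => Bv _; apply: nBv; right.
  case/(orbit_edgeP _ vu) => k [[e1 e2]|[e1 e2]].
    by move: usv; rewrite e2 iterS -e1 eqxx.
  have kn := hv x k.+1 xx (esym e2).
  have svu : v = s u by rewrite e2 e1.
  move: bvu; rewrite edge_ofC // {1}svu (IH n.-1) //; first by lia.
  move=> y l yy yl; have := hv y l.+1 yy; rewrite iterS yl -svu => /(_ erefl).
  by lia.
have X0 e : boundary X e = false.
  apply/negP => /[dup] be /bX[|[x xx /asboolP[k ek]]].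
    have [u [v [uv euv]]] := edge_ofP e; move: be; rewrite euv => be.
    by case=> h; have [Bu _] := edge_inside_end uv h; rewrite bnear // in be; auto.
  have [|n hn] := @orbit_hit_bound (xs ++ xs') (iter k s x).
    by move=> y; rewrite mem_cat => /orP[/inj|/inj'].
  by move: be; rewrite ek (orbit0 n).
move=> f; have : X f = false.
  rewrite (boundary0_constant X0 f b); apply: Xnear (or_introl Bb) _.
  by rewrite /touches eqxx.
by rewrite /X => /negbT; rewrite negb_and !negbK => /orP[] /eqP; [left|right].
Qed.
End Orbits.

(** * Counting trifurcations in a square *)

Definition box (N : nat) (z v : pt) : Prop :=
  (absz (v.1 - z.1) <= N)%N /\ (absz (v.2 - z.2) <= N)%N.

(** A suitable step towards the centre stays in the box and lowers the l1-distance to [z], on which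
    the induction runs. *)
Lemma box_connected N z : lattice_connected (box N z).
Proof.
move=> r rr rs rt radj.
suff h n v : (absz (v.1 - z.1) + absz (v.2 - z.2) <= n)%N -> box N z v -> r v z.
  by move=> x y Bx By; apply: (rt _ z); [|apply: rs]; apply: (h _ _ (leqnn _)).
elim: n v => [|n IH] v vn Bv.
  suff -> : v = z by [].
  by move: v z vn {Bv radj} => [a b] [c d] /= vn; congr pair; lia.
have step u : adjacent v u -> box N z u ->
    (absz (u.1 - z.1) + absz (u.2 - z.2) <= n)%N -> r v z.
  by move=> vu Bu un; apply: (rt _ u); [apply: radj|apply: IH].
case: (ltgtP v.1 z.1) => h1.
- by apply: (step _ (adjacent_east v)); move: Bv vn; rewrite /box /east /=; lia.
- by apply: (step _ (adjacent_west v)); move: Bv vn; rewrite /box /west /=; lia.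
case: (ltgtP v.2 z.2) => h2.
- by apply: (step _ (adjacent_north v)); move: Bv vn; rewrite /box /north /=; lia.
- by apply: (step _ (adjacent_south v)); move: Bv vn; rewrite /box /south /=; lia.
suff -> : v = z by [].
by move: v z h1 h2 {Bv radj IH vn step} => [a b] [c d] /= -> ->.
Qed.

(** Strict at [o] because squares are named by their lower-left corner: a square straddling the
    border then has a coordinate equal to [o] or [o + h]. *)
Definition in_square (o : int) (h : nat) (v : pt) : bool :=
  [&& o < v.1, v.1 <= o + h%:Z, o < v.2 & v.2 <= o + h%:Z].

(* Enumerates (with repetitions) the unit squares having corners both inside
   and outside [in_square o h]. *)
Definition ring_square (o : int) (h k : nat) : pt :=
  let q := (k %/ 4)%N%:Z in
  match (k %% 4)%N with
  | 0%N => (o, o + q) | 1%N => (o + h%:Z, o + q)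
  | 2%N => (o + q, o) | _ => (o + q, o + h%:Z) end.

Lemma ring_square_cover o h u v f : in_square o h u -> ~~ in_square o h v ->
  touches u f -> touches v f -> exists2 k, (k < 4 * h.+1)%N & ring_square o h k = f.
Proof.
move=> Qu Qv tu tv.
have [f1 [f2 side]] : o <= f.1 <= o + h%:Z /\ o <= f.2 <= o + h%:Z /\
    [\/ f.1 = o, f.1 = o + h%:Z, f.2 = o | f.2 = o + h%:Z].
  have tE (w : pt) : touches w f ->
      (f.1 == w.1) || (f.1 == w.1 - 1) /\ (f.2 == w.2) || (f.2 == w.2 - 1).
    by rewrite /touches => /or4P[] /eqP ->; rewrite /= !eqxx ?orbT.
  have [u1 u2] := tE u tu; have [v1 v2] := tE v tv.
  move: Qu Qv u1 u2 v1 v2 {tu tv tE}; rewrite /in_square => Qu Qv u1 u2 v1 v2.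
  split; [lia|split; [lia|]].
  case: (eqVneq f.1 o) => [|n1]; first by constructor 1.
  case: (eqVneq f.1 (o + h%:Z)) => [|n2]; first by constructor 2.
  case: (eqVneq f.2 o) => [|n3]; first by constructor 3.
  by constructor 4; lia.
have code (j : nat) (q : int) : (j < 4)%N -> o <= q <= o + h%:Z ->
    exists2 k, (k < 4 * h.+1)%N & (k %% 4)%N = j /\ o + (k %/ 4)%N%:Z = q.
  move=> j4 hq; exists (absz (q - o) * 4 + j)%N; first by lia.
  by rewrite modnMDl modn_small // divnMDl // divn_small // addn0; split=> //; lia.
rewrite /ring_square; case: f f1 f2 side {tu tv} => a b /= f1 f2 [] ->.
- by have [k kh [kj kq]] := code 0%N b isT f2; exists k; rewrite // kj kq.
- by have [k kh [kj kq]] := code 1%N b isT f2; exists k; rewrite // kj kq.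
- by have [k kh [kj kq]] := code 2%N a isT f1; exists k; rewrite // kj kq.
- by have [k kh [kj kq]] := code 3%N a isT f1; exists k; rewrite // kj kq.
Qed.

Section Counting.
Variable s : pt -> pt.
Hypothesis s_adj : forall x, adjacent x (s x).

(** Pigeonhole: an injective orbit cannot stay among finitely many vertices. *)
Lemma injective_orbit_leaves o h x : injective_orbit s x -> in_square o h x ->
  exists k, in_square o h (iter k s x) /\ ~~ in_square o h (iter k.+1 s x).
Proof.
move=> ix Qx; apply: contrapT => nk.
have Qk k : in_square o h (iter k s x).
  elim: k => // k Qk; apply: contraT => nQ; case: nk; by exists k.
pose code (k : 'I_(h.+1 * h.+1).+1) : 'I_h.+1 * 'I_h.+1 :=
  (inord (absz ((iter k s x).1 - o)), inord (absz ((iter k s x).2 - o))).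
have code_inj : injective code.
  move=> k l [/(congr1 (@nat_of_ord _)) + /(congr1 (@nat_of_ord _))].
  have := Qk k; have := Qk l; rewrite /in_square => Q1 Q2.
  rewrite !inordK; [|lia|lia|lia|lia] => e1 e2; apply/val_inj/ix => /=.
  by rewrite [LHS]surjective_pairing [RHS]surjective_pairing; congr pair; lia.
by have := leq_card _ code_inj; rewrite card_prod !card_ord ltnn.
Qed.

Definition trifurcation (N b : nat) (z : pt) : Prop :=
  (exists x1 x2 x3, tripod s (box N z) x1 x2 x3) /\
  forall x k, box N z (iter k s x) -> box b z x.

(** The first two orbits leave the large square across edges whose two sides lie on its perimeter,
    so the colour flips of [tripod_coloring] are visible there. *)
Lemma trifurcation_coloring N b z o h :
  (forall v, box N z v -> in_square o h v) -> trifurcation N b z ->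
  exists chi : pt -> bool * bool,
    (exists xs, [/\ supported s (box N z) xs chi,
       forall x, x \in xs -> box N z x & forall x, x \in xs -> injective_orbit s x]) /\
    let c k := chi (ring_square o h k) in
    exists k l n, [/\ k < 4 * h.+1, l < 4 * h.+1 & n < 4 * h.+1]%N /\
      [/\ c k != c l, c k != c n & c l != c n].
Proof.
move=> BQ [[x1 [x2 [x3 T]]] _].
have [chi [sup flip1 flip2]] := tripod_coloring s_adj (@box_connected N z) T.
have [[B1 B2 B3] [[i1 i2 i3] _]] := T.
exists chi; split.
  by exists [:: x1; x2; x3]; split=> // x; rewrite !inE => /or3P[] /eqP ->.
have cross x : box N z x -> injective_orbit s x -> exists k l n,
    let e := edge_of (iter k s x) (iter k.+1 s x) in
    [/\ ~ box N z (iter k.+1 s x), (l < 4 * h.+1)%N, (n < 4 * h.+1)%N,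
      ring_square o h l = e.1 & ring_square o h n = other_side e].
  move=> /BQ Qx ix; have [k [Qk nQk]] := injective_orbit_leaves ix Qx.
  have /andP[t1 t2] := touches_edge (s_adj (iter k s x)).
  have /andP[t3 t4] := touches_edge_r (s_adj (iter k s x)).
  have [l lh el] := ring_square_cover Qk nQk t1 t3.
  have [n nh en] := ring_square_cover Qk nQk t2 t4.
  by exists k, l, n; split=> // /BQ Qk1; rewrite Qk1 in nQk.
have [k [l [n [nB lh nh el en]]]] := cross _ B1 i1.
have [k' [l' [n' [nB' lh' nh' el' en']]]] := cross _ B2 i2.
have f1 := flip1 k nB; have f2 := flip2 k' nB'; rewrite -el -en in f1.
rewrite -el' -en' in f2.
pose c k := chi (ring_square o h k).
(* The colours at [l] and [n] differ but share their second component; those at [l'] and [n'] have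
   opposite second components, so one of them is a third colour. *)
have /orP[/and3P h1|/and3P h1] : [&& c l != c n, c l != c l' & c n != c l'] ||
    [&& c l != c n, c l != c n' & c n != c n'].
- rewrite /c f1 f2; case: (chi _) (chi _) => [p p'] [q q'].
  by rewrite !xpair_eqE /=; case: p p' q q' => [] [] [] [].
- by exists l, n, l'.
- by exists l, n, n'.
Qed.

Lemma trifurcation_count (m N b L : nat) : (N + b < L)%N -> (N + N < L)%N ->
  (#|[pred p : 'I_m * 'I_m |
     `[< trifurcation N b ((L * p.1)%N%:Z, (L * p.2)%N%:Z) >] ]|
    <= 4 * (L * m + N + N).+2)%N.
Proof.
move=> bL NL; pose ctr (p : 'I_m * 'I_m) : pt := ((L * p.1)%N%:Z, (L * p.2)%N%:Z).
pose I := {p : 'I_m * 'I_m | `[< trifurcation N b (ctr p) >]}.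
(* The square is chosen to contain the [N]-boxes around all the centres. *)
rewrite -card_sig -/I; pose o : int := - (N.+1)%:Z; pose h := (L * m + N + N).+1.
have BQ (i : I) v : box N (ctr (val i)) v -> in_square o h v.
  case: i => -[p q] _ /=; rewrite /box /in_square /ctr /o /h /=.
  have := leq_mul (leqnn L) (ltn_ord p); have := leq_mul (leqnn L) (ltn_ord q).
  by rewrite !mulnS; lia.
(* Distinct centres are at least [L] apart in some coordinate, and [L] exceeds both [N + N] and
   [N + b]. *)
have apart (i j : I) v : i != j -> box N (ctr (val i)) v ->
    ~ box N (ctr (val j)) v /\ ~ box b (ctr (val j)) v.
  move=> ij; have {}ij : val i != val j by [].
  suff : (L <= absz ((ctr (val i)).1 - (ctr (val j)).1))%N \/
         (L <= absz ((ctr (val i)).2 - (ctr (val j)).2))%N.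
    by rewrite /box; lia.
  have far (p q : 'I_m) : p != q -> (L <= absz ((L * p)%N%:Z - (L * q)%N%:Z))%N.
    rewrite -val_eqE /= neq_ltn => /orP[] pq.
      by have := leq_mul (leqnn L) pq; rewrite mulnS; lia.
    by have := leq_mul (leqnn L) pq; rewrite mulnS; lia.
  move: ij; rewrite /ctr; case: (val i) (val j) => [p q] [p' q'] /=.
  by rewrite xpair_eqE negb_and => /orP[/far|/far]; [left|right].
have /choice[chi chiP] : forall i : I, exists chi : pt -> bool * bool, _ :=
  fun i => trifurcation_coloring (BQ i) (asboolW (valP i)).
have cover (i j : I) : i != j -> forall f,
    chi i f = chi i (ctr (val j)) \/ chi j f = chi j (ctr (val i)).
  move=> ij; have [[xs [sup Bxs ixs]] _] := chiP i.
  have [[xs' [sup' Bxs' ixs']] _] := chiP j.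
  have self p : box N (ctr p) (ctr p) by rewrite /box !subrr.
  (* An orbit entering the [N]-box of [j1] must have started in its [b]-box, which misses the
     [N]-box of [i1]. *)
  have avoid (i1 j1 : I) x k : i1 != j1 -> box N (ctr (val i1)) x ->
      ~ box N (ctr (val j1)) (iter k s x).
    move=> ij1 Bx; have /asboolP[_ back] := valP j1 => /back.
    by case: (apart _ _ _ ij1 Bx).
  apply: (supported_compatible s_adj (@box_connected N (ctr (val i)))
    (@box_connected N (ctr (val j))) _ _ _ ixs ixs' _ _ sup sup') => //.
  - by move=> v /(apart _ _ _ ij)[].
  - by move=> x k /Bxs; apply: avoid.
  - by move=> x k /Bxs'; apply: avoid; rewrite eq_sym.
apply: (third_color_bound (chi := fun i k => chi i (ring_square o h k))).
  by move=> i; have [_] := chiP i.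
move=> i j ij; exists (chi i (ctr (val j))), (chi j (ctr (val i))) => k.
exact: cover.
Qed.
End Counting.

(** * Measurability and the nearest neighbour map *)

Section CountablePredicates.
Context {d : measure_display} {T : measurableType d}.

(** Phrased for predicates so that events are treated connective by connective, with quantifiers
    over countable types. *)
Definition measurable_pred (phi : T -> Prop) := measurable [set w | phi w].

Lemma measurable_pred_and phi psi : measurable_pred phi -> measurable_pred psi ->
  measurable_pred (fun w => phi w /\ psi w).
Proof. exact: measurableI. Qed.

Lemma measurable_pred_not phi : measurable_pred phi ->
  measurable_pred (fun w => ~ phi w).
Proof. exact: measurableC. Qed.

Lemma measurable_pred_or phi psi : measurable_pred phi -> measurable_pred psi ->
  measurable_pred (fun w => phi w \/ psi w).
Proof. exact: measurableU. Qed.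

Lemma measurable_pred_const (A : Prop) : measurable_pred (fun=> A).
Proof.
rewrite /measurable_pred; have [a|na] := pselect A.
  by rewrite (_ : mkset _ = setT) //; apply/seteqP; split.
by rewrite (_ : mkset _ = set0) //; apply/seteqP; split.
Qed.

Lemma measurable_pred_ex (I : countType) (phi : I -> T -> Prop) :
  (forall i, measurable_pred (phi i)) -> measurable_pred (fun w => exists i, phi i w).
Proof.
move=> mphi; rewrite /measurable_pred.
rewrite (_ : mkset _ = \bigcup_i [set w | phi i w]).
  by apply: countable_bigcupT_measurable => //; exact: countableP.
by apply/seteqP; split=> w /= [i]; [exists i|move=> _ ?; exists i].
Qed.

Lemma measurable_pred_ext phi psi : (forall w, phi w <-> psi w) ->
  measurable_pred phi -> measurable_pred psi.
Proof.
move=> e; rewrite /measurable_pred (_ : mkset psi = mkset phi) //.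
by apply/seteqP; split=> w /= /e.
Qed.

Lemma measurable_pred_imply phi psi : measurable_pred phi -> measurable_pred psi ->
  measurable_pred (fun w => phi w -> psi w).
Proof.
move=> m1 m2; apply: (@measurable_pred_ext (fun w => ~ phi w \/ psi w)) => [w|].
  split=> [[]|h]; [by []|by []|].
  by case: (pselect (phi w)) => [/h|]; [right|left].
by apply: measurable_pred_or => //; apply: measurable_pred_not.
Qed.

Lemma measurable_pred_all (I : countType) (phi : I -> T -> Prop) :
  (forall i, measurable_pred (phi i)) -> measurable_pred (fun w => forall i, phi i w).
Proof.
move=> mphi; apply: (@measurable_pred_ext (fun w => ~ exists i, ~ phi i w)).
  move=> w; split=> [h i|h [i]]; last by apply.
  by apply: contrapT => ni; apply: h; exists i.
apply: measurable_pred_not; apply: measurable_pred_ex => i.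
exact: measurable_pred_not.
Qed.

End CountablePredicates.

Lemma negligible_bigcup_countable d (T : measurableType d) (R : realType)
    (P : {measure set T -> \bar R}) (I : countType) (F : I -> set T) :
  (forall i, P.-negligible (F i)) -> P.-negligible (\bigcup_i F i).
Proof.
move=> nF; pose G n := if pickle_inv n is Some i then F i else set0.
apply: (@negligibleS _ _ _ _ (\bigcup_n G n)).
  by move=> w [i _ Fi]; exists (pickle i) => //; rewrite /G pickleK_inv.
apply: negligible_bigcup => n; rewrite /G; case: (pickle_inv n) => // *.
exact: negligible_set0.
Qed.

(** The sum is the expectation of the number of events that occur, which is at most [n]
    pointwise. *)
Lemma sum_probability_le d (T : measurableType d) (R : realType)
    (P : probability T R) (I : finType) (G : I -> set T) (n : nat) :
  (forall i, measurable (G i)) ->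
  (forall w, (#|[pred i | `[< G i w >]]| <= n)%N) ->
  (\sum_(i : I) P (G i) <= n%:R%:E)%E.
Proof.
move=> mG Gn.
have mI i : measurable_fun setT (fun w => (\1_(G i) w : R)%:E).
  by apply/measurable_EFinP; apply: measurable_indic.
rewrite (eq_bigr (fun i => \int[P]_w (\1_(G i) w)%:E)%E); last first.
  by move=> i _; rewrite integral_indic // setIT.
rewrite -ge0_integral_sum //.
apply: (@le_trans _ _ (\int[P]_w (cst n%:R%:E) w)%E); last first.
  rewrite integral_cst // -[leRHS]mule1; apply: lee_wpmul2l; first by rewrite lee_fin.
  exact: probability_le1.
apply: ge0_le_integral => //.
- by move=> w _; apply: sume_ge0 => i _; rewrite lee_fin.
- exact: emeasurable_sum.
- move=> w _; rewrite sumEFin lee_fin /=.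
  rewrite (eq_bigr (fun i => if `[< G i w >] then 1 else 0 : R)); last first.
    move=> i _; rewrite indicE; case: asboolP => h; first by rewrite mem_set.
    by rewrite memNset.
  rewrite -big_mkcond /= sumr_const ler_nat; exact: Gn.
Qed.

(** Disjointness of the [G i] bounds the sum of their probabilities by 1, so the [F i] have summable
    probabilities and the first Borel-Cantelli lemma applies. *)
Lemma borel_cantelli_finite d (T : measurableType d) (R : realType)
    (P : probability T R) (I : countType) (F G : I -> set T) :
  (forall i, measurable (F i)) -> (forall i, measurable (G i)) ->
  (forall i, P (F i) = P (G i)) ->
  (forall i j w, G i w -> G j w -> i = j) ->
  {ae P, forall w, finite_set [set i | F i w]}.
Proof.
move=> mF mG FG Gdisj.
pose seqE (H : I -> set T) n := if pickle_inv n is Some i then H i else set0.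
have mseq H : (forall i, measurable (H i)) -> forall n, measurable (seqE H n).
  by move=> mH n; rewrite /seqE; case: (pickle_inv n).
have lim0 : P (lim_sup_set (seqE F)) = 0%E.
  apply: lim_sup_set_cvg0; first exact: mseq.
  have PE n : P (seqE F n) = P (seqE G n) by rewrite /seqE; case: (pickle_inv n).
  rewrite (eq_eseriesr (fun n _ => PE n)) (@eq_eseriesl _ xpredT [in setT]); last first.
    by move=> n; rewrite in_setT.
  rewrite -measure_bigcup //; first 1 last.
  - by move=> n _; exact: mseq.
  - move=> m n _ _ [w []]; rewrite /seqE.
    have := @pickle_invK I m; have := @pickle_invK I n.
    case: (pickle_inv m) => // i; case: (pickle_inv n) => // j /= <- <- Gi Gj.
    by rewrite (Gdisj _ _ _ Gi Gj).
  - apply: (@le_lt_trans _ _ 1%E); last exact: ltry.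
    by apply: probability_le1; apply: bigcupT_measurable; exact: mseq.
have mlim : measurable (lim_sup_set (seqE F)).
  apply: bigcapT_measurable => n; apply: bigcup_measurable => j _; exact: mseq.
exists (lim_sup_set (seqE F)); split=> // w /=; apply: contra_notP.
rewrite /lim_sup_set => /existsNP[n /not_implyP[_ nF]].
case: (pselect (exists i : I, True)) => [[i0 _]|nI]; last first.
  suff -> : [set i | F i w] = set0 by exact: finite_set0.
  by apply/seteqP; split=> i // _; apply: nI; exists i.
apply: (@sub_finite_set _ _ ((fun n => odflt i0 (pickle_inv n)) @` `I_n)).
  move=> i /= Fi; exists (pickle i); last by rewrite pickleK_inv.
  rewrite /= ltnNge; apply/negP => ni; apply: nF; exists (pickle i) => //.
  by rewrite /seqE pickleK_inv.
exact/finite_image/finite_II.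
Qed.

(** * Translations of the lattice and conjugate maps *)

Definition translate (z v : pt) : pt := (v.1 + z.1, v.2 + z.2).

Lemma translate0 z : translate z (0, 0) = z.
Proof. by case: z => a b; rewrite /translate /= !add0r. Qed.

Lemma translateN z v : translate z (translate (- z.1, - z.2) v) = v.
Proof. by case: v => a b; rewrite /translate /= !subrK. Qed.

Lemma translateK z v : translate (- z.1, - z.2) (translate z v) = v.
Proof. by case: v => a b; rewrite /translate /= !addrK. Qed.

Lemma translate_eq z u v : (translate z u == translate z v) = (u == v).
Proof. by apply/eqP/eqP => [/(congr1 (translate (- z.1, - z.2)))|->] //; rewrite !translateK. Qed.

Lemma translate_east z v : translate z (east v) = east (translate z v).
Proof. by rewrite /translate /east /= addrAC. Qed.
Lemma translate_west z v : translate z (west v) = west (translate z v).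
Proof. by rewrite /translate /west /= addrAC. Qed.
Lemma translate_north z v : translate z (north v) = north (translate z v).
Proof. by rewrite /translate /north /= addrAC. Qed.
Lemma translate_south z v : translate z (south v) = south (translate z v).
Proof. by rewrite /translate /south /= addrAC. Qed.

Lemma translate_adjacent z u v : adjacent (translate z u) (translate z v) = adjacent u v.
Proof.
rewrite !adjacentE -translate_east -translate_west -translate_north -translate_south.
by rewrite !translate_eq.
Qed.

Lemma edge_shift_edge_of z x y :
  edge_shift z (edge_of x y) = edge_of (translate z x) (translate z y).
Proof.
rewrite /edge_of -!/(east _) -!/(north _) -!translate_east -!translate_north.
by rewrite !translate_eq !(fun_if (edge_shift z)).
Qed.

Section Translation.
Variables (s s' : pt -> pt) (z : pt).
Hypothesis ss' : forall v, translate z (s' v) = s (translate z v).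

Lemma translate_iter k v : translate z (iter k s' v) = iter k s (translate z v).
Proof. by elim: k => //= k <-; rewrite ss'. Qed.

Lemma translate_trifurcation N b c :
  trifurcation s' N b c -> trifurcation s N b (translate z c).
Proof.
have boxE n v : box n (translate z c) (translate z v) <-> box n c v.
  by rewrite /box /translate /=; split; lia.
have inj u v : translate z u = translate z v -> u = v.
  by move/eqP; rewrite translate_eq => /eqP.
have injo x : injective_orbit s' x -> injective_orbit s (translate z x).
  by move=> ix k l; rewrite -!translate_iter => /inj /ix.
have disj x y : disjoint_orbits s' x y ->
    disjoint_orbits s (translate z x) (translate z y).
  by move=> xy k l; rewrite -!translate_iter => /inj /xy.
move=> [[x1 [x2 [x3 [[B1 B2 B3] [[i1 i2 i3] [d12 d13 d23]]]]]] back]; split.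
  exists (translate z x1), (translate z x2), (translate z x3).
  by split; [split; apply/boxE|split; [split; exact: injo|split; exact: disj]].
move=> x k; rewrite -(translateN z x) -translate_iter => /boxE /back.
by move=> ?; apply/boxE.
Qed.
End Translation.

Section NearestNeighbour.
Variable R : realType.
Implicit Type w : Omega R.

(** Ties are broken in a fixed order of directions, so the map is total and translation equivariant
    for every [w]. *)
Definition nearest w (x : pt) : pt :=
  if `[< ND_edge w x (east x) >] then east x
  else if `[< ND_edge w x (west x) >] then west x
  else if `[< ND_edge w x (north x) >] then north x
  else south x.

Lemma ND_edge_nearest w x : ND_edge w x (nearest w x).
Proof.
(* The four neighbours are indexed by a finite type so that a minimal weight can be picked. *)
pose nb (i : bool * bool) :=
  if i.1 then (if i.2 then east x else west x)
  else (if i.2 then north x else south x).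
have [i [_ iP]] : exists i, adjacent x (nb i) /\
    forall j, weight w x (nb i) <= weight w x (nb j).
  case: (Order.TotalTheory.arg_minP (P := predT) (i0 := (true, true))
    (fun i => weight w x (nb i)) isT) => i _ iP; exists i; split=> [|j].
    by rewrite /nb; case: i {iP} => [[] []];
      rewrite ?adjacent_east ?adjacent_west ?adjacent_north ?adjacent_south.
  exact: iP.
have ND : ND_edge w x (nb i).
  split=> [|u].
    by rewrite /nb; case: i {iP} => [[] []];
      rewrite ?adjacent_east ?adjacent_west ?adjacent_north ?adjacent_south.
  rewrite adjacentE => /or4P[] /eqP ->.
  - exact: (iP (true, true)).
  - exact: (iP (true, false)).
  - exact: (iP (false, true)).
  - exact: (iP (false, false)).
rewrite /nearest; case: asboolP => // n1; case: asboolP => // n2.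
case: asboolP => // n3.
by move: ND; rewrite /nb; case: (i) => [[] []].
Qed.

Lemma adjacent_nearest w x : adjacent x (nearest w x).
Proof. by case: (ND_edge_nearest w x). Qed.

Lemma weight_shift z w x y :
  weight (T_shift z w) x y = weight w (translate z x) (translate z y).
Proof. by rewrite /weight /T_shift edge_shift_edge_of. Qed.

Lemma ND_edge_shift z w x y :
  ND_edge (T_shift z w) x y <-> ND_edge w (translate z x) (translate z y).
Proof.
rewrite /ND_edge translate_adjacent; split=> -[xy h]; split=> // u.
  by rewrite -(translateN z u) translate_adjacent -!weight_shift; exact: h.
by rewrite !weight_shift -(translate_adjacent z); exact: h.
Qed.

Lemma nearest_shift z w x :
  translate z (nearest (T_shift z w) x) = nearest w (translate z x).
Proof.
rewrite /nearest !(asbool_equiv_eq (ND_edge_shift z w _ _)).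
rewrite !(fun_if (translate z)).
by rewrite translate_east translate_west translate_north translate_south.
Qed.

Lemma trifurcation_shift z w N b c :
  trifurcation (nearest (T_shift z w)) N b c <->
  trifurcation (nearest w) N b (translate z c).
Proof.
split; first by apply: translate_trifurcation => v; exact: nearest_shift.
(* The converse is the same transport along the opposite translation. *)
move=> h; rewrite -[c](translateK z).
apply: (translate_trifurcation (s' := nearest w)) h => v.
by rewrite -{1}(translateN z v) -nearest_shift translateK.
Qed.

(* The first vertex of the orbit of x whose outgoing edge has weight at most q. *)
Definition first_below w (q : rat) (x y : pt) : Prop :=
  exists k, [/\ iter k (nearest w) x = y, weight w y (nearest w y) <= ratr q &
    forall j, (j < k)%N ->
      ratr q < weight w (iter j (nearest w) x) (nearest w (iter j (nearest w) x))].

Lemma first_below_unique w q x y y' :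
  first_below w q x y -> first_below w q x y' -> y = y'.
Proof.
move=> [k [<- yq kmin]] [l [<- y'q lmin]].
case: (ltngtP k l) => [kl|lk|-> //].
  by have := lt_le_trans (lmin _ kl) yq; rewrite ltxx.
by have := lt_le_trans (kmin _ lk) y'q; rewrite ltxx.
Qed.

Lemma first_below_shift z w q x y :
  first_below (T_shift z w) q x y <-> first_below w q (translate z x) (translate z y).
Proof.
have it k v := translate_iter (nearest_shift z w) k v.
have we v : weight (T_shift z w) v (nearest (T_shift z w) v) =
    weight w (translate z v) (nearest w (translate z v)).
  by rewrite weight_shift nearest_shift.
split=> -[k [ky yq kmin]]; exists k; split.
- by rewrite -it ky.
- by rewrite -we.
- by move=> j /kmin; rewrite we it.
- by apply/eqP; rewrite -(translate_eq z) it ky.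
- by rewrite we.
- by move=> j /kmin; rewrite we it.
Qed.

Lemma measurable_coordinate (e : edge) :
  measurable_fun setT (fun w : Omega R => w e).
Proof.
move=> _ B mB; rewrite setTI; apply: sub_sigma_algebra.
by exists e, B.
Qed.

Lemma measurable_weight_le x y x' y' :
  measurable_pred (fun w : Omega R => weight w x y <= weight w x' y').
Proof.
rewrite /measurable_pred -[mkset _]setTI; apply: measurable_fun_le => //;
  exact: measurable_coordinate.
Qed.

Lemma measurable_weight_le_cst x y (a : R) :
  measurable_pred (fun w : Omega R => weight w x y <= a).
Proof.
rewrite /measurable_pred -[mkset _]setTI; apply: measurable_fun_le => //.
exact: measurable_coordinate.
Qed.

Lemma measurable_ND_edge x y : measurable_pred (fun w : Omega R => ND_edge w x y).
Proof.
apply: measurable_pred_and; first exact: measurable_pred_const.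
apply: measurable_pred_all => z; apply: measurable_pred_imply.
  exact: measurable_pred_const.
exact: measurable_weight_le.
Qed.

Lemma measurable_nearest x y : measurable_pred (fun w : Omega R => nearest w x = y).
Proof.
have mif A (f : Omega R -> pt) a : measurable_pred A ->
    measurable_pred (fun w => f w = y) ->
    measurable_pred (fun w => (if `[< A w >] then a else f w) = y).
  move=> mA mf; apply: (@measurable_pred_ext _ _ (fun w => (A w /\ a = y) \/ (~ A w /\ f w = y))).
    by move=> w; case: asboolP => h; split=> [[[]|[]]|] //; [left|right].
  apply: measurable_pred_or; apply: measurable_pred_and => //.
    exact: measurable_pred_const.
  exact: measurable_pred_not.
do 3 (apply: (mif _ _ _); first exact: measurable_ND_edge).
exact: measurable_pred_const.
Qed.

Lemma measurable_iter_nearest k x y :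
  measurable_pred (fun w : Omega R => iter k (nearest w) x = y).
Proof.
elim: k y => [|k IH] y /=; first exact: measurable_pred_const.
apply: (@measurable_pred_ext _ _ (fun w => exists z, iter k (nearest w) x = z /\ nearest w z = y)).
  by move=> w; split=> [[z [-> ->]]|<-] //; exists (iter k (nearest w) x).
apply: measurable_pred_ex => z; apply: measurable_pred_and => //.
exact: measurable_nearest.
Qed.

(** Splitting over the countably many values of the iterate replaces a random vertex by a fixed
    one. *)
Lemma measurable_iter_nearest_pred (phi : Omega R -> pt -> Prop) k x :
  (forall y, measurable_pred (phi ^~ y)) ->
  measurable_pred (fun w : Omega R => phi w (iter k (nearest w) x)).
Proof.
move=> mphi.
apply: (@measurable_pred_ext _ _ (fun w => exists z, iter k (nearest w) x = z /\ phi w z)).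
  by move=> w; split=> [[z [-> ?]]|h] //; exists (iter k (nearest w) x).
apply: measurable_pred_ex => z; apply: measurable_pred_and => //.
exact: measurable_iter_nearest.
Qed.

Lemma measurable_weight_nearest x (a : R) :
  measurable_pred (fun w : Omega R => weight w x (nearest w x) <= a).
Proof.
apply: (@measurable_iter_nearest_pred (fun w y => weight w x y <= a) 1) => y.
exact: measurable_weight_le_cst.
Qed.

Lemma measurable_first_below q x y :
  measurable_pred (fun w : Omega R => first_below w q x y).
Proof.
apply: measurable_pred_ex => k.
pose lt_ w (v : pt) := ratr q < weight w v (nearest w v).
apply: (@measurable_pred_ext _ _ (fun w => iter k (nearest w) x = y /\
   (weight w y (nearest w y) <= ratr q /\
    forall j, (j < k)%N -> lt_ w (iter j (nearest w) x)))).
  by move=> w; split=> [[? []]|[]].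
apply: measurable_pred_and; first exact: measurable_iter_nearest.
apply: measurable_pred_and; first exact: measurable_weight_nearest.
apply: measurable_pred_all => j; apply: measurable_pred_imply.
  exact: measurable_pred_const.
apply: (@measurable_iter_nearest_pred lt_) => v.
apply: (@measurable_pred_ext _ _ (fun w => ~ (weight w v (nearest w v) <= ratr q))).
  by move=> w; rewrite /lt_ ltNge; split=> /negP.
by apply: measurable_pred_not; apply: measurable_weight_nearest.
Qed.

Lemma measurable_trifurcation N b c :
  measurable_pred (fun w : Omega R => trifurcation (nearest w) N b c).
Proof.
have mcst A : measurable_pred (fun _ : Omega R => A) by exact: measurable_pred_const.
have minj x : measurable_pred (fun w : Omega R => injective_orbit (nearest w) x).
  apply: measurable_pred_all => k; apply: measurable_pred_all => l.
  apply: measurable_pred_imply => //.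
  apply: (@measurable_iter_nearest_pred (fun w y => y = iter l (nearest w) x)) => y.
  apply: (@measurable_pred_ext _ _ (fun w => iter l (nearest w) x = y)) => [w|].
    by split.
  exact: measurable_iter_nearest.
have mdisj x x' : measurable_pred (fun w : Omega R => disjoint_orbits (nearest w) x x').
  apply: measurable_pred_all => k; apply: measurable_pred_all => l.
  apply: measurable_pred_not.
  apply: (@measurable_iter_nearest_pred (fun w y => y = iter l (nearest w) x')) => y.
  apply: (@measurable_pred_ext _ _ (fun w => iter l (nearest w) x' = y)) => [w|].
    by split.
  exact: measurable_iter_nearest.
apply: measurable_pred_and.
  do 3 (apply: measurable_pred_ex => ?).
  apply: measurable_pred_and; first exact: mcst.
  have mand3 (A B C : Omega R -> Prop) : measurable_pred A -> measurable_pred B ->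
      measurable_pred C -> measurable_pred (fun w => [/\ A w, B w & C w]).
    move=> mA mB mC; apply: (@measurable_pred_ext _ _ (fun w => A w /\ (B w /\ C w))).
      by move=> w; split=> [[? []]|[]].
    by do 2?apply: measurable_pred_and.
  by apply: measurable_pred_and; apply: mand3.
apply: measurable_pred_all => x; apply: measurable_pred_all => k.
apply: measurable_pred_imply => //.
exact: (@measurable_iter_nearest_pred (fun=> box N c)).
Qed.
End NearestNeighbour.

(** * Infinite components *)

Section Configuration.
Variables (R : realType) (w : Omega R).
Hypothesis w_inj : forall e f : edge, w e = w f -> e = f.
Local Notation s := (nearest w).
Local Notation out v := (weight w v (nearest w v)).

Lemma out_le v u : adjacent v u -> out v <= weight w v u.
Proof. by move=> vu; case: (ND_edge_nearest w v) => _; apply. Qed.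

Lemma out_inj u v : out u = out v -> u = v \/ u = s v.
Proof.
move=> /w_inj /(edge_of_inj (adjacent_nearest w u) (adjacent_nearest w v)).
by case=> -[-> _]; [left|right].
Qed.

(** The edge back to [v] competes for the minimum at [s v]. *)
Lemma out_nearest_le v : out (s v) <= out v.
Proof.
apply: le_trans (out_le (u := v) _) _.
  by rewrite adjacent_sym adjacent_nearest.
by rewrite /weight edge_ofC // adjacent_sym adjacent_nearest.
Qed.

Lemma out_iter_le k l v : (k <= l)%N -> out (iter l s v) <= out (iter k s v).
Proof.
move/subnK <-; elim: (l - k)%N => // m IH.
by rewrite addSn iterS; apply: le_trans (out_nearest_le _) IH.
Qed.

Lemma out_nearest_eq v : out (s v) = out v -> s (s v) = v.
Proof.
move=> /w_inj /(edge_of_inj (adjacent_nearest w (s v)) (adjacent_nearest w v)).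
case=> -[e1 e2] //; have := adjacent_neq (adjacent_nearest w v).
by rewrite e1 eqxx.
Qed.

Lemma N_edgeE u v : N_edge w u v -> v = s u \/ u = s v.
Proof.
have half x y : ND_edge w x y -> y = s x.
  move=> [xy ymin]; have := adjacent_nearest w x => xs.
  have /w_inj : weight w x y = out x by apply/le_anti; rewrite ymin // out_le.
  case/(edge_of_inj xy xs) => -[] // e _.
  by have := adjacent_neq xs; rewrite -e eqxx.
by case=> /half; [left|right].
Qed.

Lemma N_edge_nearest v : N_edge w v (s v).
Proof. by left; exact: ND_edge_nearest. Qed.

Lemma N_connected_iter k v : N_connected w v (iter k s v).
Proof.
elim: k => [|k IH]; first exact: rt_refl.
exact: rt_trans IH (rt_step _ _ _ _ (N_edge_nearest _)).
Qed.

Lemma N_connected_sym u v : N_connected w u v -> N_connected w v u.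
Proof.
elim=> [x y xy|x|x y z _ yx _ zy]; [|exact: rt_refl|exact: rt_trans zy yx].
by apply: rt_step; case: xy; [right|left].
Qed.

Lemma N_component_eq u v : N_connected w u v -> N_component w u = N_component w v.
Proof.
move=> uv; apply/seteqP; split=> x; rewrite /N_component /=.
  exact: rt_trans (N_connected_sym uv).
exact: rt_trans.
Qed.

Definition ancestors (y : pt) : set pt := [set x | exists k, iter k s x = y].

(** On the orbit of an ancestor [x], let [v] be the first vertex with [out v <= out y]. Monotonicity
    gives equality, so [v] is [y] or [s y]. Either [x = v], or a rational between [out v] and the
    larger [out p] of the predecessor [p] makes [x] send its mass to [v]; only finitely many pairs
    [(p, v)] arise. *)
Lemma finite_ancestors y :
  (forall q v, finite_set [set x | first_below w q x v]) ->
  finite_set (ancestors y).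
Proof.
move=> fin.
(* The threshold depends on the pair alone; 0 is a default for pairs without a strict drop. *)
have /choice[Q QP] : forall pv : pt * pt, exists q : rat,
    out pv.2 < out pv.1 -> out pv.2 <= ratr q < out pv.1.
  move=> [p v] /=; case: (ltP (out v) (out p)) => [vp|_]; last by exists 0.
  have [q] := rat_in_itvoo vp; rewrite in_itv /= => /andP[q1 q2].
  by exists q => _; rewrite q2 (ltW q1).
pose V : set pt := [set` [:: y; s y]].
pose nb v : set pt := [set` [:: east v; west v; north v; south v]].
apply: (@sub_finite_set _ _ (V `|` \bigcup_(v in V) \bigcup_(p in nb v)
   [set x | first_below w (Q (p, v)) x v])); last first.
  rewrite finite_setU; split; first exact: finite_seq.
  apply: bigcup_finite => [|v _]; first exact: finite_seq.
  by apply: bigcup_finite => [|p _]; [exact: finite_seq|exact: fin].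
move=> x [k xk]; pose low j := out (iter j s x) <= out y.
have ex : exists j, low j by exists k; rewrite /low xk.
case: (ex_minnP ex) => j jlow jmin; set v := iter j s x.
have vy : out v <= out y := jlow.
have Vv : V v.
  have jk : (j <= k)%N by apply: jmin; rewrite /low xk.
  have /out_inj : out v = out y.
    by apply/le_anti; rewrite vy; have := out_iter_le x jk; rewrite xk.
  by rewrite /V /= !inE => -[->|->]; rewrite eqxx ?orbT.
case: j => [|j] in jlow jmin v vy Vv *; first by left.
right; exists v => //; pose p := iter j s x; exists p.
  rewrite /nb /= -/(is_true _) !inE -adjacentE adjacent_sym; exact: adjacent_nearest.
have yp : out y < out p by rewrite ltNge; apply/negP => /jmin; rewrite ltnn.
have /andP[q1 q2] := QP (p, v) (le_lt_trans vy yp).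
exists j.+1; split=> // i ij; apply: lt_le_trans q2 _.
exact: out_iter_le.
Qed.

(** A repetition makes [out] constant along the cycle, which is then a two-cycle at some [v]; the
    whole component would consist of ancestors of [v], a finite set. *)
Lemma infinite_injective_orbit x :
  (forall y, finite_set (ancestors y)) -> ~ finite_set (N_component w x) ->
  injective_orbit s x.
Proof.
move=> fin inf; suff lt k l : (k < l)%N -> iter k s x <> iter l s x.
  by move=> k l e; case: (ltngtP k l) => // [/lt|/lt /nesym].
move=> kl e; apply: inf; set v := iter k s x in e.
have ssv : s (s v) = v.
  apply: out_nearest_eq; apply/le_anti; rewrite out_nearest_le /=.
  by have := @out_iter_le k.+1 l x kl; rewrite -e.
apply: sub_finite_set (fin v) => y /= xy.
have : ancestors v x by exists k.
(* The ancestors of [v] are closed under edges of the graph: the only way to step past [v] leads to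
   [s v], which returns to [v]. *)
elim: xy => {y} [u u'|//|a b c _ IH1 _ IH2 /IH1 //].
move=> /N_edgeE[->|->] [[|j] uj].
- by exists 1%N; move: uj => /= ->.
- by exists j; rewrite -iterSr.
- by exists 1%N.
- by exists j.+2; rewrite iterSr.
Qed.

Lemma finite_box N : finite_set (box N (0, 0)).
Proof.
pose I : set int := (Posz @` `I_N.+1) `|` ((fun n => - Posz n) @` `I_N.+1).
have finI : finite_set I.
  by rewrite finite_setU; split; apply: finite_image; exact: finite_II.
apply: (@sub_finite_set _ _ (I `*` I)); last exact: finite_setX.
have inI i : (absz (i - 0) <= N)%N -> I i.
  move=> iN; case: (lerP 0 i) => i0; [left|right]; exists (absz i); rewrite /=; lia.
by move=> v [/inI ? /inI ?].
Qed.

Lemma finite_sub_box (A : set pt) : finite_set A -> exists b, A `<=` box b (0, 0).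
Proof.
move=> /finite_seqP[xs ->]; elim: xs => [|x xs [b IH]]; first by exists 0%N.
exists (maxn b (maxn (absz x.1) (absz x.2))) => v /=.
by rewrite inE => /predU1P[->|/IH]; rewrite /box /=; lia.
Qed.

Lemma three_components_trifurcation :
  (forall q y, finite_set [set x | first_below w q x y]) ->
  ~ at_most_two_infinite_components w ->
  exists N b, trifurcation s N b (0, 0).
Proof.
move=> finq many; have fin y : finite_set (ancestors y) by exact: finite_ancestors.
have [x1 [x2 [x3 [[f1 f2 f3] [d12 d13 d23]]]]] : exists x1 x2 x3,
    [/\ ~ finite_set (N_component w x1), ~ finite_set (N_component w x2)
      & ~ finite_set (N_component w x3)] /\
    [/\ N_component w x1 <> N_component w x2, N_component w x1 <> N_component w x3
      & N_component w x2 <> N_component w x3].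
  apply: contrapT => nx; apply: many => _ _ _ [[x1 ->] f1] [[x2 ->] f2] [[x3 ->] f3].
  apply: contrapT => /not_orP[d12 /not_orP[d13 d23]]; apply: nx.
  by exists x1, x2, x3.
have disj x y : N_component w x <> N_component w y -> disjoint_orbits s x y.
  move=> xy k l e; apply: xy; rewrite (N_component_eq (N_connected_iter k x)) e.
  exact/esym/N_component_eq/N_connected_iter.
(* [N] encloses one point of each component, and then [b] the finitely many ancestors of that
   box. *)
have [N BN] := finite_sub_box (finite_seq [:: x1; x2; x3]).
have [b Bb] : exists b, \bigcup_(y in box N (0, 0)) ancestors y `<=` box b (0, 0).
  by apply: finite_sub_box; apply: bigcup_finite => // ; exact: finite_box.
exists N, b; split; last by move=> x k Bx; apply: Bb; exists (iter k s x) => //; exists k.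
exists x1, x2, x3; split; last by split; split; auto; exact: infinite_injective_orbit.
by split; apply: BN; rewrite /= !inE eqxx ?orbT.
Qed.
End Configuration.

(** * Consequences of translation invariance *)

Section Measure.
Variables (R : realType) (P : probability (Omega R) R).
Hypothesis HA1 : translation_invariant P.

Lemma shift_invariant (phi psi : Omega R -> Prop) z :
  measurable_pred phi -> (forall w, phi (T_shift z w) <-> psi w) ->
  P [set w | psi w] = P [set w | phi w].
Proof.
move=> mphi e; rewrite -(HA1 z mphi); congr (P _).
by apply/seteqP; split=> w /= /e.
Qed.

(* Mass transport: by invariance, the expected number of x sending mass to y
   equals the expected number of vertices to which y sends mass. *)
Lemma ae_finite_first_below q y :
  {ae P, forall w, finite_set [set x | first_below w q x y]}.
Proof.
(* Translating by [y - x] carries the pair [(x, y)] to [(y, 2y - x)]. As [y] sends its mass to at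
   most one vertex, the translated events are disjoint in [x]. *)
apply: (@borel_cantelli_finite _ _ _ P _ (fun x => [set w | first_below w q x y])
  (fun x => [set w | first_below w q y (translate (y.1 - x.1, y.2 - x.2) y)])).
- by move=> x; exact: measurable_first_below.
- by move=> x; exact: measurable_first_below.
- move=> x; apply/esym; apply: (@shift_invariant (fun w => first_below w q x y) _
    (y.1 - x.1, y.2 - x.2)); first exact: measurable_first_below.
  move=> w; rewrite first_below_shift (_ : translate _ x = y) //.
  by rewrite /translate /= ![_ + (_ - _)]addrC !subrK -surjective_pairing.
- move=> x x' w /= F F'; have := first_below_unique F F'.
  by case: x x' {F F'} => [a b] [c d]; rewrite /translate /= => -[? ?]; congr pair; lia.
Qed.

(** The expected number of trifurcations among [m * m] translates is quadratic in [m] unless the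
    probability is zero, while [trifurcation_count] bounds it linearly. *)
Lemma trifurcation_null N b :
  P [set w | trifurcation (nearest w) N b (0, 0)] = 0%E.
Proof.
set G := [set w | _]; have mG : measurable G by exact: measurable_trifurcation.
(* [L] meets both spacing conditions, and [m * c] dominates the perimeter bound for every positive
   [m]. *)
pose L := (N + N + b).+1; pose c := (4 * (L + N + N).+2)%N.
have Gfin : P G \is a fin_num by exact: fin_num_measure.
have bound m : (m * m)%:R * fine (P G) <= (4 * (L * m + N + N).+2)%:R.
  pose H (p : 'I_m * 'I_m) := [set w : Omega R |
    trifurcation (nearest w) N b ((L * p.1)%N%:Z, (L * p.2)%N%:Z)].
  have PH p : P (H p) = P G.
    apply: (@shift_invariant (fun w => trifurcation (nearest w) N b (0, 0)) _
      ((L * p.1)%N%:Z, (L * p.2)%N%:Z)); first exact: measurable_trifurcation.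
    by move=> w; rewrite trifurcation_shift translate0.
  have := @sum_probability_le _ _ _ P _ H (4 * (L * m + N + N).+2).
  rewrite (eq_bigr (fun=> P G)) => [|p _]; last exact: PH.
  rewrite -(fineK Gfin) sumEFin lee_fin sumr_const card_prod !card_ord mulr_natl.
  apply=> [p|w]; first exact: measurable_trifurcation.
  apply: trifurcation_count; [exact: adjacent_nearest|rewrite /L; lia|rewrite /L; lia].
apply/eqP; rewrite -(fineK Gfin) eqe eq_le fine_ge0 // andbT leNgt.
apply/negP => p0.
(* For such [m], the left side of [bound] exceeds [m * c]. *)
have [m mP] : exists m, c%:R / fine (P G) < m%:R :> R.
  by exists (Num.bound (c%:R / fine (P G))); apply: archi_boundP; rewrite divr_ge0 // ltW.
have m0 : (0 < m)%N.
  by rewrite -(ltr0n R); apply: le_lt_trans mP; rewrite divr_ge0 // ltW.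
have := bound m; apply/negP; rewrite -ltNge.
rewrite ltr_pdivrMr // in mP.
apply: (@le_lt_trans _ _ (m%:R * c%:R)); last first.
  by rewrite natrM -mulrA ltr_pM2l // ltr0n.
rewrite -natrM ler_nat /c; nia.
Qed.
End Measure.

(** * The almost sure statement, by excluding null events *)

Theorem theorem2 (R : realType) (P : probability (Omega R) R)
  (HA1 : translation_invariant P) (HA2 : distinct_weights P) :
  {ae P, forall w : Omega R, at_most_two_infinite_components w}.
Proof.
have ties : P.-negligible (\bigcup_(ef : edge * edge)
    [set w : Omega R | ef.1 <> ef.2 /\ w ef.1 = w ef.2]).
  apply: negligible_bigcup_countable => -[e f] /=.
  have mle (e' f' : edge) : measurable_pred (fun w : Omega R => w e' <= w f').
    rewrite /measurable_pred -[mkset _]setTI; apply: measurable_fun_le => //;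
      exact: measurable_coordinate.
  have mef : measurable_pred (fun w : Omega R => e <> f /\ w e = w f).
    apply: (@measurable_pred_ext _ _ (fun w : Omega R => e <> f /\ (w e <= w f /\ w f <= w e))).
      move=> w; split=> -[ef]; last by move=> ->.
      by move=> [l1 l2]; split=> //; apply/le_anti; rewrite l1 l2.
    apply: measurable_pred_and; first exact: measurable_pred_const.
    exact: measurable_pred_and.
  apply/negligibleP => //; have [ef|nef] := pselect (e = f).
    by rewrite (_ : mkset _ = set0) ?measure0 //; apply/seteqP; split=> w // [].
  rewrite -(HA2 e f nef); congr (P _); apply/seteqP; split=> w /=; first by case.
  by split.
have infinite_sources : P.-negligible (\bigcup_(qy : rat * pt)
    ~` [set w : Omega R | finite_set [set x | first_below w qy.1 x qy.2]]).
  by apply: negligible_bigcup_countable => -[q y]; exact: ae_finite_first_below.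
have tri : P.-negligible (\bigcup_(Nb : nat * nat)
    [set w : Omega R | trifurcation (nearest w) Nb.1 Nb.2 (0, 0)]).
  apply: negligible_bigcup_countable => -[N b] /=; apply/negligibleP.
    exact: measurable_trifurcation.
  exact: trifurcation_null.
(* A configuration with three infinite components has a tie, or a vertex receiving infinite mass at
   some rational level, or a trifurcation at the origin for some sizes. *)
apply: negligibleS (negligibleU ties (negligibleU infinite_sources tri)) => w many.
have [w_inj|/existsNP[e /existsNP[f /not_implyP[ef nef]]]] :=
  pselect (forall e f, w e = w f -> e = f); last by left; exists (e, f).
have [fin|/existsNP[q /existsNP[y nf]]] := pselect (forall q y,
  finite_set [set x | first_below w q x y]); last by right; left; exists (q, y).
have [N [b Nb]] := three_components_trifurcation w_inj fin many.
by right; right; exists (N, b).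
Qed.
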